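(* Let $T,S,X,Y\in\mathcal{B}_A(\mathcal{H})$. Then, for each choice of sign, $$w_A(TXS\pm SYT)\leq 2\sqrt{2}\,\|S\|_A\max\{\|X\|_A,\|Y\|_A\}\sqrt{w_A^2(T)-\frac{\big|\,\|\mathrm{Re}_A(T)\|_A^2-\|\mathrm{Im}_A(T)\|_A^2\,\big|}{2}}.$$
   Context: $(\mathcal{H},\langle\cdot,\cdot\rangle)$ is a complex Hilbert space, $\mathcal{B}(\mathcal{H})$ is the algebra of bounded linear operators on $\mathcal{H}$, and $A\in\mathcal{B}(\mathcal{H})$ is a fixed positive operator ($\langle Ax,x\rangle\ge 0$ for all $x$). Put $\langle x,y\rangle_A=\langle Ax,y\rangle$ and $\|x\|_A=\sqrt{\langle x,x\rangle_A}$ (a seminorm). $\mathcal{B}_A(\mathcal{H})=\{T\in\mathcal{B}(\mathcal{H}): \mathrm{ran}(T^*A)\subseteq \mathrm{ran}(A)\}$, equivalently the set of $T$ for which some $S\in\mathcal{B}(\mathcal{H})$ satisfies $AS=T^*A$. For $T\in\mathcal{B}_A(\mathcal{H})$, $T^{\sharp_A}$ is the reduced solution of $AX=T^*A$, i.e. the unique $X\in\mathcal{B}(\mathcal{H})$ with $AX=T^*A$ and $\mathrm{ran}(X)\subseteq\overline{\mathrm{ran}(A)}$ (equivalently $T^{\sharp_A}=A^{\dagger}T^*A$, with $A^\dagger$ the Moore–Penrose inverse). Also $\mathrm{Re}_A(T)=\frac12(T+T^{\sharp_A})$, $\mathrm{Im}_A(T)=\frac1{2i}(T-T^{\sharp_A})$;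 the $A$-operator seminorm is $\|T\|_A=\sup\{\|Tx\|_A: x\in\mathcal{H},\ \|x\|_A=1\}$ and the $A$-numerical radius is $w_A(T)=\sup\{|\langle Tx,x\rangle_A|: x\in\mathcal{H},\ \|x\|_A=1\}$; $w_A^2(T)=(w_A(T))^2$. *)

(* Defs.v *)
From HB Require Import structures.
From mathcomp Require Import all_boot all_order all_algebra.
From mathcomp Require Import sesquilinear complex.
From mathcomp Require Import all_classical all_reals all_analysis.

Set Implicit Arguments.
Unset Strict Implicit.
Unset Printing Implicit Defensive.

Import Order.TTheory GRing.Theory Num.Theory.
Import numFieldNormedType.Exports.

Local Open Scope classical_set_scope.
Local Open Scope ring_scope.
Local Open Scope complex_scope.

(* A complex Hilbert space is a complete normed module [H] over [R[i]] together
   with an inner product [dot], linear in its first argument and conjugate-linear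
   in the second, such that [hilbert_dot dot].
   Operators are plain functions [H -> H]; linearity and boundedness are
   expressed by membership in [bounded_op]. *)
Section SemiHilbert.
Variables (R : realType) (H : completeNormedModType R[i]).
Variable dot : {dot H for (@Num.conj R[i])}.
Implicit Types (A T X S : H -> H) (x y : H).

Definition hilbert_dot : Prop := forall x, dot x x = `|x| ^+ 2.

Definition bounded_op : set (H -> H) :=
  [set T | linear T /\ exists M : R[i], forall x, `|T x| <= M * `|x|].

(* Hilbert adjoint: it exists (Riesz) and is unique for [T] in [bounded_op];
   the default value [cst 0] only matters for the other functions. *)
Definition adjoint T : H -> H :=
  xget (cst 0)
    [set S | bounded_op S /\ forall x y, dot (T x) y = dot x (S y)].

(* [0 <= z] in [R[i]] says that [z] is a nonnegative real. *)
Definition positive_op A : Prop := forall x, 0 <= dot (A x) x.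

Definition dotA A x y : R[i] := dot (A x) y.

(* [dotA A x x] is a nonnegative real when [A] is positive; taking its real
   part only makes the seminorm [R]-valued. *)
Definition normA A x : R := Num.sqrt (complex.Re (dotA A x x)).

Definition B_A A : set (H -> H) :=
  [set T | bounded_op T /\ range (adjoint T \o A) `<=` range A].

(* Reduced solution of [A X = T^* A]: for [A] positive and bounded, and [T] in
   [B_A A], it exists (Douglas) and is unique. *)
Definition sharp A T : H -> H :=
  xget (cst 0)
    [set X | [/\ bounded_op X, A \o X = adjoint T \o A
                & range X `<=` closure (range A)]].

Definition ReA A T : H -> H := fun x => 2^-1 *: (T x + sharp A T x).

Definition ImA A T : H -> H := fun x => (2 * 'i)^-1 *: (T x - sharp A T x).

(* The suprema below are taken in [R], where [sup] is [0] on sets that are empty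
   or unbounded above. For [T] in [B_A A] both sets are bounded above; they are
   empty exactly when [A = 0], which gives the usual convention [sup set0 = 0]. *)
Definition opnormA A T : R :=
  sup [set normA A (T x) | x in [set x | normA A x = 1]].

Definition numradA A T : R :=
  sup [set Normc.normc (dotA A (T x) x) | x in [set x | normA A x = 1]].

End SemiHilbert.

(* Main.v *)
Require Import Defs.
From HB Require Import structures.
From mathcomp Require Import all_boot all_order all_algebra.
From mathcomp Require Import sesquilinear complex.
From mathcomp Require Import all_classical all_reals all_analysis.
From mathcomp Require Import ring lra.

(** Write |x| for the A-seminorm, |T| for the A-operator seminorm, w for the
    A-numerical radius of T, and T# for the reduced A-adjoint, which satisfies
    <Tx, y>_A = <x, T# y>_A.

    For |x| = 1, moving T and S across the form gives
      |<(TXS +- SYT)x, x>_A| <= |XSx| |T# x| + |YTx| |S# x|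
                             <= |S| max(|X|, |Y|) (|Tx| + |T# x|),
    since an A-adjoint has the same bounds as the operator itself.  With
    P = Re_A T and Q = Im_A T the parallelogram law turns the last factor into
      (|Tx| + |T# x|)^2 <= 2 (|Tx|^2 + |T# x|^2) = 4 (|Px|^2 + |Qx|^2)
                        <= 4 (|P|^2 + |Q|^2).
    P and Q are A-selfadjoint and their quadratic forms are the real and
    imaginary parts of the form of T, so |P| <= w and |Q| <= w
    ([selfadjoint_bound]).  Finally
      |P|^2 + |Q|^2 = 2 max(|P|^2, |Q|^2) - | |P|^2 - |Q|^2 |
                   <= 2 (w^2 - | |P|^2 - |Q|^2 | / 2),
    and taking square roots gives the constant 2 sqrt 2.

    This computation needs two facts about members T of B_A: that T# exists
    ([sharpP]) and that |T| is finite ([B_A_seminorm_bounded]).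

    Existence is Douglas's factorization theorem.  Each equation
    A z = T^* A y has a solution, and projecting it orthogonally onto the
    closure of ran A gives the unique solution there, hence a linear map.  It
    is bounded because |A T u|_H <= C |A u|_H ([range_majorization]): the
    vectors A T u with |A u|_H <= 1 are weakly bounded, as
    <y, A T u> = <z, A u>, hence bounded by the uniform boundedness principle.

    Finiteness is Lax's theorem applied to the A-selfadjoint bounded operator
    K = T# T: the values |K^k x| grow geometrically with ratio at least
    |Kx| / |x|, and boundedness of K on H caps that ratio
    ([selfadjoint_seminorm_le]); then |Tx|^2 = <Kx, x>_A <= |K|_H |x|^2. *)

Set Implicit Arguments.
Unset Strict Implicit.
Unset Printing Implicit Defensive.

Import Order.TTheory GRing.Theory Num.Theory.
Import numFieldNormedType.Exports.

Local Open Scope classical_set_scope.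
Local Open Scope ring_scope.

(** * Real and complex numbers *)

Lemma quadratic_ge0_discr (R : realFieldType) (a b c : R) : 0 <= a ->
  (forall t, 0 <= a * t ^+ 2 + 2 * b * t + c) -> b ^+ 2 <= a * c.
Proof.
rewrite le_eqVlt => /predU1P[<-|a0] h.
  have [->|b0] := eqVneq b 0; first by rewrite expr0n mul0r.
  have := h (- (c + 1) / (2 * b)).
  have -> : 2 * b * (- (c + 1) / (2 * b)) = - (c + 1) by field.
  lra.
have := h (- b / a).
have -> : a * (- b / a) ^+ 2 + 2 * b * (- b / a) + c = (a * c - b ^+ 2) / a.
  by field; lra.
by rewrite pmulr_lge0 ?invr_gt0// subr_ge0.
Qed.

Lemma bernoulli_ineq (R : realFieldType) (h : R) n :
  0 <= h -> 1 + h *+ n <= (1 + h) ^+ n.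
Proof.
move=> h0; elim: n => [|n IH]; first by rewrite mulr0n addr0 expr0.
rewrite exprS mulrDl mul1r mulrS.
have h1 : 0 <= h *+ n by exact: mulrn_wge0.
have h2 : 0 <= h * (h *+ n) by exact: mulr_ge0.
have := ler_wpM2l h0 IH; lra.
Qed.

(** An exponential lower bound and an exponential upper bound can only coexist
    when the rates are ordered, whatever the constants. *)
Lemma le_of_geometric_growth (R : realType) (r M a C : R) :
  0 <= M -> 0 < a -> (forall n : nat, r ^+ n * a <= C * M ^+ n) -> r <= M.
Proof.
rewrite le_eqVlt => /predU1P[<-|M0] a0 h; rewrite leNgt; apply/negP => rM.
  by have := h 1%N; rewrite !expr1 mulr0 leNgt mulr_gt0.
have h0 : 0 < r / M - 1 by rewrite subr_gt0 ltr_pdivlMr// mul1r.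
have [n hn] : exists n : nat, C / a / (r / M - 1) < n%:R.
  by exists (Num.truncn (C / a / (r / M - 1))).+1; exact: truncnS_gt.
move: hn; rewrite ltr_pdivrMr// => hn.
have := bernoulli_ineq n (ltW h0); rewrite [1 + (_ - _)]addrC subrK => hb.
have hCa : C / a < (r / M) ^+ n.
  by apply: lt_le_trans hn _; apply: le_trans hb; rewrite mulr_natl lerDr.
have := h n; rewrite leNgt => /negP; apply.
by rewrite -ltr_pdivrMr// mulrAC -ltr_pdivlMr ?exprn_gt0// -expr_div_n.
Qed.

Lemma normc_sqr (R : realType) (z : R[i]) :
  Normc.normc z ^+ 2 = complex.Re z ^+ 2 + complex.Im z ^+ 2.
Proof. by case: z => a b /=; rewrite sqr_sqrtr// addr_ge0// sqr_ge0. Qed.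

Lemma normc_ge0 (R : realType) (z : R[i]) : 0 <= Normc.normc z.
Proof. by case: z => a b; exact: sqrtr_ge0. Qed.

Lemma Re_le_normc (R : realType) (z : R[i]) : `|complex.Re z| <= Normc.normc z.
Proof.
rewrite -(ler_pXn2r (n := 2)) ?nnegrE ?normc_ge0//.
by rewrite real_normK ?num_real// normc_sqr lerDl sqr_ge0.
Qed.

Lemma Im_le_normc (R : realType) (z : R[i]) : `|complex.Im z| <= Normc.normc z.
Proof.
rewrite -(ler_pXn2r (n := 2)) ?nnegrE ?normc_ge0//.
by rewrite real_normK ?num_real// normc_sqr lerDr sqr_ge0.
Qed.

Lemma normcE (R : realType) (z : R[i]) : `|z| = (Normc.normc z)%:C%C.
Proof. by case: z. Qed.

Lemma normc_conj_mul (R : realType) (z : R[i]) :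
  complex.Re (conjc z * z) = Normc.normc z ^+ 2.
Proof. by rewrite normc_sqr; case: z => a b /=; ring. Qed.

(** Multiplying by [i] exposes the imaginary part; since a subspace is stable
    under it, orthogonality can be tested on real parts. *)
Lemma Re_eq0_complex (R : realType) (z : R[i]) :
  complex.Re z = 0 -> complex.Re ('i%C * z) = 0 -> z = 0.
Proof.
by case: z => a b /= -> /eqP; rewrite mul0r mul1r sub0r oppr_eq0 => /eqP ->.
Qed.

(** * Linear maps *)

Section LinearMaps.
Variables (R : realType) (U V : lmodType R[i]) (T : U -> V).
Hypothesis linT : linear T.

Lemma linear_add x y : T (x + y) = T x + T y.
Proof. by have := linT 1 x y; rewrite !scale1r. Qed.

Lemma linear_at0 : T 0 = 0.
Proof. by apply: (addrI (T 0)); rewrite -linear_add !addr0. Qed.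

Lemma linear_scale c x : T (c *: x) = c *: T x.
Proof. by have := linT c x 0; rewrite linear_at0 !addr0. Qed.

Lemma linear_opp x : T (- x) = - T x.
Proof. by rewrite -scaleN1r linear_scale scaleN1r. Qed.

Lemma linear_sub x y : T (x - y) = T x - T y.
Proof. by rewrite linear_add linear_opp. Qed.
End LinearMaps.

Lemma linear_id (R : realType) (U : lmodType R[i]) : linear (@id U).
Proof. by []. Qed.

Lemma linear_comp (R : realType) (U : lmodType R[i]) (T S : U -> U) :
  linear T -> linear S -> linear (T \o S).
Proof. by move=> lT lS c x y /=; rewrite lS lT. Qed.

(** * The semi-inner product of a positive operator *)

Section SemiInnerProduct.
Variables (R : realType) (H : completeNormedModType R[i]).
Variable dot : {dot H for (@Num.conj R[i])}.
Variable A : H -> H.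
Hypothesis linA : linear A.
Hypothesis posA : positive_op dot A.
Implicit Types (x y z : H) (c : R[i]).

Local Notation "[< x , y >]" := (dotA dot A x y).
Local Notation n := (normA dot A).

(** This real symmetric bilinear form has the same seminorm as the complex one,
    so that inequalities can be proved by real arithmetic. *)
Definition rdot x y : R := complex.Re [< x, y >].

Lemma dotADl x y z : [< x + y, z >] = [< x, z >] + [< y, z >].
Proof. by rewrite /dotA linear_add// linearDl. Qed.

Lemma dotAZl c x y : [< c *: x, y >] = c * [< x, y >].
Proof. by rewrite /dotA linear_scale// linearZl_LR. Qed.

Lemma dotADr x y z : [< x, y + z >] = [< x, y >] + [< x, z >].
Proof. by rewrite /dotA linearDr. Qed.

Lemma dotAZr c x y : [< x, c *: y >] = conjc c * [< x, y >].
Proof. by rewrite /dotA linearZr_LR. Qed.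

Lemma dotA_real x : complex.Im [< x, x >] = 0.
Proof. exact/ger0_Im/posA. Qed.

(** Over the complex numbers positivity forces symmetry: the forms at [x + y]
    and at [x + i y] are real. *)
Lemma dotA_sym x y : [< y, x >] = conjc [< x, y >].
Proof.
have := dotA_real (x + y); have := dotA_real (x + 'i%C *: y).
rewrite !(dotADl, dotADr, dotAZl, dotAZr) !raddfD /=.
have := dotA_real y; have := dotA_real x.
case: [< x, x >] => a1 a2 /= ->; case: [< y, y >] => b1 b2 /= ->.
case: [< x, y >] => u1 u2; case: [< y, x >] => v1 v2 /=.
move=> h1 h2; have {}h1 : v1 - u1 = 0 by rewrite -[RHS]h1; ring.
have {}h2 : v2 + u2 = 0 by rewrite -[RHS]h2; ring.
by congr (_ +i* _)%C; lra.
Qed.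

Lemma rdotC x y : rdot x y = rdot y x.
Proof. by rewrite /rdot dotA_sym; case: [< _, _ >]. Qed.

Lemma rdotDl x y z : rdot (x + y) z = rdot x z + rdot y z.
Proof. by rewrite /rdot dotADl raddfD. Qed.

Lemma rdotDr x y z : rdot x (y + z) = rdot x y + rdot x z.
Proof. by rewrite /rdot dotADr raddfD. Qed.

Lemma rdotZl (t : R) x y : rdot (t%:C%C *: x) y = t * rdot x y.
Proof. by rewrite /rdot dotAZl; case: [< _, _ >] => a b /=; ring. Qed.

Lemma rdotZr (t : R) x y : rdot x (t%:C%C *: y) = t * rdot x y.
Proof. by rewrite rdotC rdotZl rdotC. Qed.

Lemma rdotNl x y : rdot (- x) y = - rdot x y.
Proof.
have -> : - x = (-1 : R)%:C%C *: x by rewrite rmorphN scaleN1r.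
by rewrite rdotZl mulN1r.
Qed.

Lemma rdotNr x y : rdot x (- y) = - rdot x y.
Proof. by rewrite rdotC rdotNl rdotC. Qed.

Definition rdotE := (rdotDl, rdotDr, rdotNl, rdotNr, rdotZl, rdotZr).

Lemma normA_ge0 x : 0 <= n x. Proof. exact: sqrtr_ge0. Qed.

Lemma rdotxx x : rdot x x = n x ^+ 2.
Proof.
by rewrite sqr_sqrtr//; have := posA x; rewrite lecE => /andP[].
Qed.

Lemma normAZ c x : n (c *: x) = Normc.normc c * n x.
Proof.
apply/eqP.
rewrite -(eqrXn2 (n := 2)) ?normA_ge0 ?mulr_ge0 ?normA_ge0 ?normc_ge0//.
rewrite exprMn -!rdotxx /rdot dotAZl dotAZr -normc_conj_mul.
have := dotA_real x; case: [< _, _ >] => a b /= ->; case: c => u v /=.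
by apply/eqP; ring.
Qed.

Lemma normAZr (t : R) x : n (t%:C%C *: x) = `|t| * n x.
Proof. by rewrite normAZ /= expr0n /= addr0 sqrtr_sqr. Qed.

Lemma normA0 : n 0 = 0.
Proof.
by rewrite -(scale0r 0) -[0](rmorph0 (real_complex R)) normAZr normr0 mul0r.
Qed.

Lemma normAN x : n (- x) = n x.
Proof.
apply/eqP; rewrite -(eqrXn2 (n := 2)) ?normA_ge0//.
by rewrite -!rdotxx !rdotE opprK.
Qed.

(** Cauchy-Schwarz, from the discriminant of [t |-> n (t x + y) ^+ 2]; the form
    may be degenerate, so there is no dividing by a seminorm. *)
Lemma rdot_le x y : rdot x y <= n x * n y.
Proof.
have h : rdot x y ^+ 2 <= n x ^+ 2 * n y ^+ 2.
  apply: quadratic_ge0_discr; first exact: sqr_ge0.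
  move=> t; have := sqr_ge0 (n (t%:C%C *: x + y)).
  rewrite -[X in _ <= X -> _]rdotxx !rdotE !rdotxx (rdotC y x) => h.
  apply: le_trans h _.
  by rewrite le_eqVlt; apply/orP; left; apply/eqP; ring.
apply: le_trans (ler_norm _) _.
rewrite -(ler_pXn2r (n := 2)) ?nnegrE ?mulr_ge0 ?normA_ge0//.
by rewrite real_normK ?num_real// exprMn.
Qed.

Lemma rdot_abs_le x y : `|rdot x y| <= n x * n y.
Proof.
rewrite ler_norml rdot_le andbT lerNl -rdotNl.
by apply: le_trans (rdot_le _ _) _; rewrite normAN.
Qed.

Lemma dotA_le x y : Normc.normc [< x, y >] <= n x * n y.
Proof.
set z := [< x, y >].
have [z0|z0] := eqVneq (Normc.normc z) 0.
  by rewrite z0 mulr_ge0 ?normA_ge0.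
have zp : 0 < Normc.normc z by rewrite lt_def z0 normc_ge0.
(* multiplying x by conj z makes the form real, equal to |z| ^ 2 *)
have := rdot_le (conjc z *: x) y.
rewrite /rdot dotAZl normc_conj_mul normAZ -/z.
have -> : Normc.normc (conjc z) = Normc.normc z.
  by case: z {z0 zp} => a b /=; rewrite sqrrN.
by rewrite -mulrA expr2 ler_pM2l.
Qed.

Lemma normAD x y : n (x + y) <= n x + n y.
Proof.
rewrite -(ler_pXn2r (n := 2)) ?nnegrE ?addr_ge0 ?normA_ge0//.
rewrite -rdotxx !rdotE !rdotxx (rdotC y x).
by have := rdot_le x y; lra.
Qed.

Lemma normAB x y : n (x - y) <= n x + n y.
Proof. by rewrite -(normAN y) normAD. Qed.

Lemma parallelogram x y :
  n (x + y) ^+ 2 + n (x - y) ^+ 2 = 2 * (n x ^+ 2 + n y ^+ 2).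
Proof. by rewrite -!rdotxx !rdotE; ring. Qed.

Lemma normA_subC x y : n (x - y) = n (y - x).
Proof. by rewrite -opprB normAN. Qed.

End SemiInnerProduct.

(** * Operator seminorm and numerical radius *)

Section OperatorSeminorms.
Variables (R : realType) (H : completeNormedModType R[i]).
Variable dot : {dot H for (@Num.conj R[i])}.
Variable A : H -> H.
Hypothesis linA : linear A.
Hypothesis posA : positive_op dot A.
Implicit Types (x y z : H) (T S W P : H -> H).

Local Notation "[< x , y >]" := (dotA dot A x y).
Local Notation n := (normA dot A).
Local Notation rdA := (rdot dot A).

Definition seminorm_bounded T := exists c : R, forall x, n (T x) <= c * n x.

Definition A_adjoint T W := forall x y, [< T x, y >] = [< x, W y >].

Lemma A_adjoint_sym T W : A_adjoint T W -> A_adjoint W T.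
Proof. by move=> adj x y; rewrite dotA_sym// -adj -dotA_sym. Qed.

Lemma rdot_adjoint T W x y : A_adjoint T W -> rdA (T x) y = rdA x (W y).
Proof. by rewrite /rdot => ->. Qed.

(** When no vector has seminorm 1 the supremum is [sup set0 = 0], whence the
    hypothesis [0 <= c]. *)
Lemma sup_image_le (f : H -> R) (c : R) : 0 <= c ->
  (forall x, n x = 1 -> f x <= c) ->
  sup [set f x | x in [set x | n x = 1]] <= c.
Proof.
move=> c0 h; set E := [set _ | _ in _].
have [->|E0] := eqVneq E set0; first by rewrite sup0.
by apply: ge_sup; [exact/set0P|move=> _ [x xn <-]; exact: h].
Qed.

Lemma le_sup_image (f : H -> R) (c : R) x :
  (forall x, n x = 1 -> f x <= c) -> n x = 1 ->
  f x <= sup [set f x | x in [set x | n x = 1]].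
Proof.
move=> h x1; apply: ub_le_sup; last by exists x.
by exists c => _ [y yn <-]; exact: h.
Qed.

Lemma sup_image_ge0 (f : H -> R) :
  (forall x, 0 <= f x) -> 0 <= sup [set f x | x in [set x | n x = 1]].
Proof.
move=> f0; set E := [set _ | _ in _].
have [[[y Ey] Eub]|hE] := pselect (has_sup E); last by rewrite sup_out.
by apply: le_trans (ub_le_sup Eub Ey); case: Ey => x _ <-.
Qed.

Lemma opnormA_ge0 T : 0 <= opnormA dot A T.
Proof. by apply: sup_image_ge0 => x; exact: normA_ge0. Qed.

Lemma numradA_ge0 T : 0 <= numradA dot A T.
Proof. by apply: sup_image_ge0 => x; exact: normc_ge0. Qed.

Lemma normA_normalize x : n x != 0 -> n ((n x)^-1%:C%C *: x) = 1.
Proof.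
by move=> x0; rewrite normAZr// ger0_norm ?invr_ge0 ?normA_ge0// mulVf.
Qed.

(** A-boundedness is what makes the supremum finite, and also what makes [T]
    preserve the vectors of seminorm 0, which cannot be normalized. *)
Lemma opnormA_bound T : linear T -> seminorm_bounded T ->
  forall x, n (T x) <= opnormA dot A T * n x.
Proof.
move=> linT [c hc] x; have [x0|x0] := eqVneq (n x) 0.
  by have := hc x; rewrite x0 !mulr0.
rewrite -ler_pdivrMr ?lt_def ?x0 ?normA_ge0//.
have -> : n (T x) / n x = n (T ((n x)^-1%:C%C *: x)).
  rewrite (linear_scale linT) normAZr// ger0_norm ?invr_ge0 ?normA_ge0//.
  by rewrite mulrC.
apply: (@le_sup_image (n \o T) c _ _ (normA_normalize x0)) => y y1 /=.
by rewrite -[c]mulr1 -y1 hc.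
Qed.

Lemma numradA_bound T : linear T -> seminorm_bounded T ->
  forall x, Normc.normc [< T x, x >] <= numradA dot A T * n x ^+ 2.
Proof.
move=> linT [c hc] x; have [x0|x0] := eqVneq (n x) 0.
  have := dotA_le linA posA (T x) x.
  by rewrite x0 expr0n !mulr0.
rewrite -ler_pdivrMr ?exprn_gt0 ?lt_def ?x0 ?normA_ge0//.
have -> : Normc.normc [< T x, x >] / n x ^+ 2 =
    Normc.normc [< T ((n x)^-1%:C%C *: x), (n x)^-1%:C%C *: x >].
  rewrite (linear_scale linT) dotAZl// dotAZr// !Normc.normcM.
  rewrite mulrA mulrC; congr (_ * _).
  rewrite /= oppr0 expr0n/= addr0 sqrtr_sqr -expr2 real_normK ?num_real//.
  by rewrite exprVn.
apply: (@le_sup_image (fun x => Normc.normc [< T x, x >]) c _ _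
  (normA_normalize x0)).
move=> y y1 /=; apply: le_trans (dotA_le _ _ _ _) _ => //.
by rewrite y1 mulr1 -[c]mulr1 -y1 hc.
Qed.

(** [n (W x) ^+ 2 = <T (W x), x>_A <= c * n (W x) * n x]. *)
Lemma A_adjoint_bounded T W (c : R) : A_adjoint T W ->
  (forall x, n (T x) <= c * n x) -> forall x, n (W x) <= c * n x.
Proof.
move=> adj hc x; have [W0|W0] := eqVneq (n (W x)) 0.
  have [x0|x0] := eqVneq (n x) 0; first by rewrite W0 x0 mulr0.
  rewrite W0 mulr_ge0 ?normA_ge0//.
  rewrite -(pmulr_lge0 _ (_ : 0 < n x)) ?lt_def ?x0 ?normA_ge0//.
  exact: le_trans (normA_ge0 _ _ _) (hc x).
have Wp : 0 < n (W x) by rewrite lt_def W0 normA_ge0.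
rewrite -(ler_pM2r Wp) -expr2 -(rdotxx posA) -(rdot_adjoint _ _ adj).
apply: le_trans (rdot_le linA posA _ _) _.
by rewrite mulrAC ler_wpM2r ?normA_ge0.
Qed.

(** For an A-selfadjoint operator the quadratic form controls the seminorm: by
    polarization it bounds the pairing of [P x] with any [y], and [y] is then
    taken along [P x]. *)
Lemma selfadjoint_bound P (w : R) : linear P -> 0 <= w ->
  A_adjoint P P -> (forall x, `|rdA (P x) x| <= w * n x ^+ 2) ->
  forall x, n (P x) <= w * n x.
Proof.
move=> linP w0 adj hw x.
have [P0|P0] := eqVneq (n (P x)) 0.
  by rewrite P0 mulr_ge0 ?normA_ge0.
have polar y : 4 * rdA (P x) y <= w * (2 * (n x ^+ 2 + n y ^+ 2)).
  rewrite -(parallelogram linA posA) mulrDr.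
  have /ler_normlP[_ h1] := hw (x + y); have /ler_normlP[h2 _] := hw (x - y).
  apply: le_trans (lerD h1 h2).
  rewrite !(linear_add linP, linear_opp linP) !(rdotE linA posA).
  rewrite (rdot_adjoint y x adj) (rdotC linA posA y); lra.
(* the bound at y = t P x is a quadratic inequality valid for every real t *)
have : (- n (P x) ^+ 2) ^+ 2 <= w * n (P x) ^+ 2 * (w * n x ^+ 2).
  apply: quadratic_ge0_discr; first by rewrite mulr_ge0 ?sqr_ge0.
  move=> t; have := polar (t%:C%C *: P x).
  rewrite (rdotZr linA posA) (rdotxx posA) normAZr// exprMn.
  by rewrite real_normK ?num_real//; lra.
have Pp : 0 < n (P x) ^+ 2 by rewrite exprn_even_gt0.
have -> : w * n (P x) ^+ 2 * (w * n x ^+ 2) = n (P x) ^+ 2 * (w * n x) ^+ 2.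
  by ring.
by rewrite sqrrN expr2 ler_pM2l// ler_pXn2r ?nnegrE ?mulr_ge0 ?normA_ge0.
Qed.

(** * The inequality for operators with A-adjoints *)

Section Commutator.
Variables (T T' S S' X Y : H -> H).
Hypotheses (linT : linear T) (linT' : linear T') (linS : linear S).
Hypotheses (linX : linear X) (linY : linear Y).
Hypotheses (bT : seminorm_bounded T) (bS : seminorm_bounded S).
Hypotheses (bX : seminorm_bounded X) (bY : seminorm_bounded Y).
Hypotheses (adjT : A_adjoint T T') (adjS : A_adjoint S S').

Let P x := 2^-1 *: (T x + T' x).
Let Q x := (2 * 'i%C)^-1 *: (T x - T' x).
Let w := numradA dot A T.

Let half : (2^-1 : R[i]) = (2^-1 : R)%:C%C.
Proof. by rewrite fmorphV rmorph_nat. Qed.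

Let ihalf : ((2 * 'i%C)^-1 : R[i]) = (0 +i* - (2^-1))%C.
Proof.
have i0 : 2 * 'i%C != 0 :> R[i].
  by rewrite mulf_neq0 ?pnatr_eq0// eq_complex /= oner_eq0 andbF.
apply: (mulfI i0); rewrite divff// -[2](rmorph_nat (real_complex R)).
by apply/eqP; rewrite eq_complex /=; apply/andP; split; apply/eqP; field.
Qed.

Lemma normA_ReA x : n (P x) = n (T x + T' x) / 2.
Proof. by rewrite /P half normAZr// ger0_norm ?invr_ge0// mulrC. Qed.

Lemma normA_ImA x : n (Q x) = n (T x - T' x) / 2.
Proof.
rewrite /Q ihalf normAZ// mulrC; congr (_ * _).
by rewrite /= expr0n add0r sqrrN sqrtr_sqr ger0_norm// invr_ge0.
Qed.

Let linP : linear P.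
Proof.
move=> c x y; rewrite /P linT linT' addrACA (scalerDr 2^-1) -(scalerDr c).
by rewrite !scalerA mulrC.
Qed.

Let linQ : linear Q.
Proof.
move=> c x y; rewrite /Q linT linT' opprD addrACA (scalerDr (2 * _)^-1).
by rewrite -(scalerBr c) !scalerA mulrC.
Qed.

Let adjP : A_adjoint P P.
Proof.
move=> x y; rewrite /P dotAZl// dotAZr// dotADl// dotADr// adjT.
by rewrite (A_adjoint_sym adjT) half addrC; congr (_ * _); rewrite /= oppr0.
Qed.

Let dotANl x y : [< - x, y >] = - [< x, y >].
Proof. by rewrite -scaleN1r dotAZl// mulN1r. Qed.

Let dotANr x y : [< x, - y >] = - [< x, y >].
Proof. by rewrite /dotA linearNr. Qed.

Let adjQ : A_adjoint Q Q.
Proof.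
move=> x y; rewrite /Q dotAZl// dotAZr// dotADl// dotADr// dotANl dotANr.
rewrite adjT (A_adjoint_sym adjT) ihalf.
case: [< x, T' y >] => a b; case: [< x, T y >] => c d.
by apply/eqP; rewrite eq_complex /=; apply/andP; split; apply/eqP; ring.
Qed.

Let T'E x : [< T' x, x >] = conjc [< T x, x >].
Proof. by rewrite (A_adjoint_sym adjT) dotA_sym. Qed.

(** The quadratic form of [P] is the real part of that of [T]. *)
Lemma opnormA_ReA_le : opnormA dot A P <= w.
Proof.
apply: sup_image_le => [|x x1]; first exact: numradA_ge0.
rewrite -[w]mulr1 -x1; apply: selfadjoint_bound => //; first exact: numradA_ge0.
move=> y; apply: le_trans (numradA_bound linT bT y).
apply: le_trans (Re_le_normc _); rewrite /rdot /P dotAZl// dotADl// T'E half.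
case: [< T y, y >] => a b /=; rewrite le_eqVlt; apply/orP; left.
by apply/eqP; congr `| _ |; field.
Qed.

(** The quadratic form of [Q] is the imaginary part of that of [T]. *)
Lemma opnormA_ImA_le : opnormA dot A Q <= w.
Proof.
apply: sup_image_le => [|x x1]; first exact: numradA_ge0.
rewrite -[w]mulr1 -x1; apply: selfadjoint_bound => //; first exact: numradA_ge0.
move=> y; apply: le_trans (numradA_bound linT bT y).
apply: le_trans (Im_le_normc _).
rewrite /rdot /Q dotAZl// dotADl// dotANl T'E ihalf.
case: [< T y, y >] => a b /=; rewrite le_eqVlt; apply/orP; left.
by apply/eqP; congr `| _ |; field.
Qed.

Let p := opnormA dot A P.
Let q := opnormA dot A Q.

Lemma seminorm_bounded_comb (U V : H -> H) (a b : R[i]) :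
  seminorm_bounded U -> seminorm_bounded V ->
  seminorm_bounded (fun x => a *: (U x + b *: V x)).
Proof.
move=> [c hc] [d hd]; exists (Normc.normc a * (c + Normc.normc b * d)) => x.
rewrite normAZ// -mulrA ler_wpM2l ?normc_ge0//.
apply: le_trans (normAD linA posA _ _) _; rewrite mulrDl lerD//.
by rewrite normAZ// -mulrA ler_wpM2l ?normc_ge0.
Qed.

Let bT' : seminorm_bounded T'.
Proof. by case: bT => c hc; exists c; exact: A_adjoint_bounded adjT hc. Qed.

Let bP : seminorm_bounded P.
Proof.
have [c hc] := seminorm_bounded_comb 2^-1 1 bT bT'.
by exists c => x; have := hc x; rewrite scale1r.
Qed.

Let bQ : seminorm_bounded Q.
Proof.
have [c hc] := seminorm_bounded_comb (2 * 'i%C)^-1 (-1) bT bT'.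
by exists c => x; have := hc x; rewrite scaleN1r.
Qed.

Lemma sum_sqr_ReA_ImA x :
  n (T x) ^+ 2 + n (T' x) ^+ 2 = 2 * (n (P x) ^+ 2 + n (Q x) ^+ 2).
Proof.
have := parallelogram linA posA (T x) (T' x).
by rewrite normA_ReA normA_ImA; lra.
Qed.

Lemma sum_normA_le x : n x = 1 -> n (T x) + n (T' x) <=
  2 * Num.sqrt 2 * Num.sqrt (w ^+ 2 - `|p ^+ 2 - q ^+ 2| / 2).
Proof.
move=> x1.
have Pp : n (P x) ^+ 2 <= p ^+ 2.
  rewrite ler_pXn2r ?nnegrE ?normA_ge0 ?opnormA_ge0//.
  by have := opnormA_bound linP bP x; rewrite x1 mulr1.
have Qq : n (Q x) ^+ 2 <= q ^+ 2.
  rewrite ler_pXn2r ?nnegrE ?normA_ge0 ?opnormA_ge0//.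
  by have := opnormA_bound linQ bQ x; rewrite x1 mulr1.
have pw : p ^+ 2 <= w ^+ 2.
  by rewrite ler_pXn2r ?nnegrE ?opnormA_ge0 ?numradA_ge0 ?opnormA_ReA_le.
have qw : q ^+ 2 <= w ^+ 2.
  by rewrite ler_pXn2r ?nnegrE ?opnormA_ge0 ?numradA_ge0 ?opnormA_ImA_le.
(* p ^ 2 + q ^ 2 + |p ^ 2 - q ^ 2| is twice the larger of p ^ 2 and q ^ 2 *)
have key : p ^+ 2 + q ^+ 2 <= 2 * (w ^+ 2 - `|p ^+ 2 - q ^+ 2| / 2).
  by have [_|_] := ger0P (p ^+ 2 - q ^+ 2); lra.
have k0 : 0 <= w ^+ 2 - `|p ^+ 2 - q ^+ 2| / 2.
  by have := sqr_ge0 p; have := sqr_ge0 q; lra.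
rewrite -(ler_pXn2r (n := 2)) ?nnegrE ?addr_ge0 ?mulr_ge0 ?normA_ge0//.
rewrite !exprMn !sqr_sqrtr//.
have := sum_sqr_ReA_ImA x; have := sqr_ge0 (n (T x) - n (T' x)).
by lra.
Qed.

Let m := Num.max (opnormA dot A X) (opnormA dot A Y).
Let s := opnormA dot A S.
Let bound := 2 * Num.sqrt 2 * s * m
  * Num.sqrt (w ^+ 2 - `|p ^+ 2 - q ^+ 2| / 2).

Let m0 : 0 <= m. Proof. by rewrite le_max opnormA_ge0. Qed.

Lemma commutator_forms_le x : n x = 1 ->
  Normc.normc [< T (X (S x)), x >] + Normc.normc [< S (Y (T x)), x >] <= bound.
Proof.
move=> x1; have s0 : 0 <= s by exact: opnormA_ge0.
rewrite adjT adjS.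
have h1 : Normc.normc [< X (S x), T' x >] <= s * m * n (T' x).
  apply: le_trans (dotA_le linA posA _ _) _; rewrite ler_wpM2r ?normA_ge0//.
  apply: le_trans (opnormA_bound linX bX _) _.
  rewrite mulrC; apply: ler_pM; rewrite ?normA_ge0 ?opnormA_ge0 ?le_max ?lexx//.
  by have := opnormA_bound linS bS x; rewrite x1 mulr1.
have h2 : Normc.normc [< Y (T x), S' x >] <= s * m * n (T x).
  apply: le_trans (dotA_le linA posA _ _) _.
  rewrite mulrC -mulrA; apply: ler_pM; rewrite ?normA_ge0//.
    have := A_adjoint_bounded adjS (opnormA_bound linS bS) x.
    by rewrite x1 mulr1.
  apply: le_trans (opnormA_bound linY bY _) _.
  by rewrite ler_wpM2r ?normA_ge0// le_max lexx orbT.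
apply: le_trans (lerD h1 h2) _; rewrite -mulrDr.
have -> : bound = s * m *
    (2 * Num.sqrt 2 * Num.sqrt (w ^+ 2 - `|p ^+ 2 - q ^+ 2| / 2)).
  by rewrite /bound; ring.
by rewrite ler_wpM2l ?mulr_ge0// addrC sum_normA_le.
Qed.

Let bound_ge0 : 0 <= bound.
Proof. by rewrite !mulr_ge0 ?sqrtr_ge0 ?opnormA_ge0. Qed.

Lemma numradA_sum_le : numradA dot A ((T \o X \o S) \+ (S \o Y \o T)) <= bound.
Proof.
apply: sup_image_le => // x x1; apply: le_trans (commutator_forms_le x1).
by rewrite dotADl// le_normcD.
Qed.

Lemma numradA_sub_le : numradA dot A ((T \o X \o S) \- (S \o Y \o T)) <= bound.
Proof.
apply: sup_image_le => // x x1; apply: le_trans (commutator_forms_le x1).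
by rewrite dotADl// dotANl; apply: le_trans (le_normcD _ _) _; rewrite normcN.
Qed.

End Commutator.
End OperatorSeminorms.

(** * Orthogonal projection *)

Section HilbertSpace.
Variables (R : realType) (H : completeNormedModType R[i]).
Variable dot : {dot H for (@Num.conj R[i])}.
Hypothesis hdot : hilbert_dot dot.
Implicit Types (x y z : H) (T : H -> H) (M : set H) (e : R).

(** The norm of [H] as a real number; it is the seminorm of the identity. *)
Local Notation nrm := (normA dot id).
Local Notation rd := (rdot dot id).
Local Notation lid := (@linear_id R H).

Lemma positive_id : positive_op dot id.
Proof. by move=> x; rewrite hdot exprn_ge0. Qed.
Local Notation pid := positive_id.

Lemma hnormE x : `|x| = (nrm x)%:C%C.
Proof.
have : `|x| \is Num.real by rewrite ger0_real.
case/complex_realP => r xr; rewrite /normA /dotA hdot xr -rmorphXn /= sqrtr_sqr.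
by rewrite ger0_norm//; have := normr_ge0 x; rewrite xr ler0c.
Qed.

Lemma nrm_eq0 x : nrm x = 0 -> x = 0.
Proof. by move=> x0; apply/eqP; rewrite -normr_eq0 hnormE x0. Qed.

(** The bound in [bounded_op] is a complex number, of which only the modulus
    matters, even when the space is trivial and the bound not real. *)
Lemma bounded_opP T : bounded_op T <->
  linear T /\ exists2 c : R, 0 <= c & forall x, nrm (T x) <= c * nrm x.
Proof.
split=> [[linT [M hM]]|[linT [c c0 hc]]]; split=> //.
  exists (Normc.normc M) => [|x]; first exact: normc_ge0.
  rewrite -lecR rmorphM/= -!hnormE -normcE -[X in _ * X]normr_id -normrM.
  by rewrite ger0_norm ?hM// (le_trans _ (hM x)).
exists c%:C%C => x; rewrite !hnormE -rmorphM lecR; exact: hc.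
Qed.

Lemma exists_invn_lt e : 0 < e -> exists N : nat, N.+1%:R^-1 < e.
Proof.
move=> e0; exists (Num.truncn e^-1).
by rewrite -[e]invrK ltf_pV2 ?posrE ?invr_gt0// ?invrK truncnS_gt.
Qed.

(** Completeness with an explicit rate, inherited by the limit; both the
    projection and the uniform boundedness argument need the rate. *)
Lemma cvg_of_tail_bound (u : nat -> H) (e : nat -> R) :
  (forall d : R, 0 < d -> exists N, e N < d) ->
  (forall k m, (k <= m)%N -> nrm (u m - u k) <= e k) ->
  exists x, forall k, nrm (x - u k) <= e k.
Proof.
move=> e0 hu.
have cu : cauchy (u @ \oo).
  apply: cauchy_exP => r r0.
  have /complex_realP[d rd'] : r \is Num.real by rewrite gtr0_real.
  move: r0; rewrite rd' => r0; have d0 : 0 < d by rewrite -ltcR.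
  have [N eN] := e0 _ d0; exists (u N); exists N => //= k Nk.
  rewrite -ball_normE /= hnormE ltcR normA_subC//.
  by apply: le_lt_trans eN; exact: hu.
have ux : u @ \oo --> lim (u @ \oo) by exact: (@cauchy_cvg _ _ _ cu).
exists (lim (u @ \oo)) => k; move: ux; set x := lim _ => ux.
apply/ler_addgt0Pr => d d0.
have /cvgrPdist_le/(_ d%:C%C) := ux; rewrite ltcR => /(_ d0)[N _ hN].
have := hN (maxn N k) (leq_maxl _ _); rewrite /= hnormE lecR => h1.
rewrite -(subrK (u (maxn N k)) x) -addrA.
apply: le_trans (normAD lid pid _ _) _; rewrite [e k + d]addrC lerD//.
exact/hu/leq_maxr.
Qed.

(** Closedness in terms of the real-valued norm, so that no topology on the
    complex scalars has to be handled. *)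
Definition norm_closed M := forall x,
  (forall e, 0 < e -> exists2 m, M m & nrm (x - m) < e) -> M x.

Definition linear_subspace M :=
  M 0 /\ forall c x y, M x -> M y -> M (c *: x + y).

Section Projection.
Variable M : set H.
Hypotheses (subM : linear_subspace M) (closedM : norm_closed M).
Variable x : H.

Let E := [set nrm (x - m) ^+ 2 | m in M].
Let d := inf E.

Let E_lb : has_lbound E.
Proof. by exists 0 => _ [m _ <-]; exact: sqr_ge0. Qed.

Let d_le m : M m -> d <= nrm (x - m) ^+ 2.
Proof. by move=> Mm; apply: ge_inf => //; exists m. Qed.

Let ME c y z : M y -> M z -> M (c *: y + z).
Proof. exact: subM.2. Qed.

Let d0 : 0 <= d.
Proof.
apply: lb_le_inf; first by exists (nrm (x - 0) ^+ 2), 0 => //; exact: subM.1.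
by move=> _ [m _ <-]; exact: sqr_ge0.
Qed.

(** By the parallelogram law a minimizing sequence is a Cauchy sequence. *)
Let close_minimizers y z e1 e2 : M y -> M z ->
  nrm (x - y) ^+ 2 <= d + e1 -> nrm (x - z) ^+ 2 <= d + e2 ->
  nrm (y - z) ^+ 2 <= 2 * (e1 + e2).
Proof.
move=> My Mz hy hz.
have M0 : M (2^-1%:C%C *: y + 2^-1%:C%C *: z).
  apply: ME => //; rewrite -[_ *: z]addr0; apply: ME => //; exact: subM.1.
have := d_le M0; have := parallelogram lid pid (x - y) (x - z).
have -> : x - y - (x - z) = z - y by rewrite opprB addrC subrKA.
have -> : x - y + (x - z) = 2%:C%C *: (x - (2^-1%:C%C *: y + 2^-1%:C%C *: z)).
  rewrite scalerBr scalerDr !scalerA -!rmorphM /= mulfV// !scale1r.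
  rewrite [2%:C%C](rmorph_nat (real_complex R)) scaler_nat mulr2n opprD.
  by rewrite addrACA.
rewrite normAZr// exprMn ger0_norm// (normA_subC lid pid y).
lra.
Qed.

Lemma orthogonal_projection :
  exists2 p, M p & forall m, M m -> dot (x - p) m = 0.
Proof.
have /choice[u hu] : forall k : nat, exists m, M m /\
    nrm (x - m) ^+ 2 <= d + (k.+1%:R^-1 / 2) ^+ 2.
  move=> k.
  have [||_ [m Mm <-] /ltW hm] := @inf_adherent _ E ((k.+1%:R^-1 / 2) ^+ 2).
  - by rewrite exprn_gt0// divr_gt0// invr_gt0.
  - by split=> //; exists (nrm (x - 0) ^+ 2), 0 => //; exact: subM.1.
  - by exists m.
(* an excess of (1 / (2 (k + 1))) ^ 2 over the infimum puts all later terms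
   within 1 / (k + 1) of the k-th *)
have [||p hp] := @cvg_of_tail_bound u (fun k => k.+1%:R^-1).
- exact: exists_invn_lt.
- move=> k m km; rewrite -(ler_pXn2r (n := 2)) ?nnegrE ?normA_ge0 ?invr_ge0//.
  apply: le_trans (close_minimizers (hu m).1 (hu k).1 (hu m).2 (hu k).2) _.
  have : m.+1%:R^-1 <= k.+1%:R^-1 :> R by rewrite lef_pV2 ?posrE// ler_nat.
  rewrite -(ler_pXn2r (n := 2)) ?nnegrE ?invr_ge0// !expr_div_n.
  by move: (m.+1%:R^-1 ^+ 2) (k.+1%:R^-1 ^+ 2) => a b; lra.
have Mp : M p.
  apply: closedM => e e0; have [N eN] := exists_invn_lt e0.
  by exists (u N); [exact: (hu N).1|exact: le_lt_trans (hp N) eN].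
have pmin : nrm (x - p) ^+ 2 <= d.
  have h : nrm (x - p) <= Num.sqrt d.
    apply/ler_addgt0Pr => e e0.
    have [N eN] := @exists_invn_lt (e / 2) (divr_gt0 e0 (ltr0Sn _ _)).
    have iN : 0 < N.+1%:R^-1 :> R by rewrite invr_gt0.
    have h1 : nrm (x - u N) <= Num.sqrt d + N.+1%:R^-1 / 2.
      have hN : 0 <= N.+1%:R^-1 / 2 :> R by rewrite divr_ge0// ltW.
      rewrite -(ler_pXn2r (n := 2)) ?nnegrE ?normA_ge0 ?addr_ge0 ?sqrtr_ge0//.
      apply: le_trans (hu N).2 _; rewrite sqrrD sqr_sqrtr//.
      have : 0 <= Num.sqrt d * (N.+1%:R^-1 / 2).
        by rewrite mulr_ge0 ?sqrtr_ge0.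
      by move: (Num.sqrt d * _) (_ ^+ 2) => a b; lra.
    have := normAB lid pid (x - u N) (p - u N).
    have -> : x - u N - (p - u N) = x - p by rewrite opprB addrA subrK.
    by move: (hp N) h1 eN => /=; move: N.+1%:R^-1 => a; lra.
  by rewrite -[d]sqr_sqrtr// ler_pXn2r ?nnegrE ?normA_ge0 ?sqrtr_ge0.
exists p => // m0 Mm0.
have orth m : M m -> rd (x - p) m = 0.
  move=> Mm; apply/eqP; rewrite -sqrf_eq0 eq_le sqr_ge0 andbT.
  rewrite -(sqrrN (rd _ _)) -(mulr0 (nrm m ^+ 2)).
  apply: quadratic_ge0_discr; first exact: sqr_ge0.
  move=> t; have := le_trans pmin (d_le (ME t%:C%C Mm Mp)).
  rewrite [_ *: m + p]addrC opprD addrA; move: (x - p) => y.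
  rewrite -!(rdotxx pid) !(rdotE lid pid) (rdotC lid pid m); lra.
apply: Re_eq0_complex; first exact: orth.
rewrite -linearZl_LR/=.
have := orth ((- 'i%C) *: m0); rewrite /rdot dotAZr -linearZl_LR.
have -> : conjc (- 'i%C) = 'i%C :> R[i] by rewrite /= oppr0 opprK.
apply; rewrite -[_ *: _]addr0; apply: ME => //; exact: subM.1.
Qed.
End Projection.

End HilbertSpace.

(** * Riesz representation, adjoints, uniform boundedness *)

Section HilbertOperators.
Variables (R : realType) (H : completeNormedModType R[i]).
Variable dot : {dot H for (@Num.conj R[i])}.
Hypothesis hdot : hilbert_dot dot.
Implicit Types (x y z : H) (T : H -> H) (e c : R).

Local Notation nrm := (normA dot id).
Local Notation rd := (rdot dot id).
Local Notation lid := (@linear_id R H).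
Local Notation pid := (positive_id hdot).

Lemma eq_dotr y z : (forall x, dot x y = dot x z) -> y = z.
Proof.
move=> h; apply/eqP; rewrite -subr_eq0; apply/eqP/(nrm_eq0 hdot).
have h0 : dot (y - z) (y - z) = 0.
  by rewrite linearBr/= h subrr.
by apply/eqP; rewrite -sqrf_eq0 -(rdotxx pid) /rdot /dotA h0.
Qed.

Lemma dot_conj x y : dot y x = conjc (dot x y).
Proof. exact: (dotA_sym lid pid). Qed.

(** The representing vector is a multiple of the component of any [x0] outside
    the kernel of [f] that is orthogonal to that kernel. *)
Lemma riesz_representation (f : H -> R[i]) c : scalar f ->
  (forall x, Normc.normc (f x) <= c * nrm x) ->
  exists z, forall x, f x = dot x z.
Proof.
move=> linf hf.
have f0 : f 0 = 0.
  have := linf 1 0 0; rewrite scale1r mul1r !addr0 => h.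
  by apply: (addrI (f 0)); rewrite addr0 -h.
have fB x y : f (x - y) = f x - f y.
  by rewrite -scaleN1r addrC linf mulN1r addrC.
pose M : set H := [set x | f x = 0].
have subM : linear_subspace M.
  by split=> // a x y fx fy; rewrite /M /= linf fx fy mulr0 addr0.
have closedM : norm_closed dot M.
  move=> x hx; apply: Normc.eq0_normc; apply/eqP; rewrite eq_le normc_ge0 andbT.
  apply/ler_addgt0Pr => e e0; rewrite add0r.
  have [|m fm] := hx (e / (`|c| + 1)); first by rewrite divr_gt0// ltr_wpDl.
  rewrite ltr_pdivlMr ?ltr_wpDl// => hm.
  rewrite -[f x]subr0 -fm -fB; apply: le_trans (hf _) _.
  apply: le_trans (ltW hm); rewrite mulrC ler_wpM2l ?normA_ge0//.
  by rewrite (le_trans (ler_norm c))// lerDl.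
have [fz|/existsNP[x0 fx0]] := pselect (forall x, f x = 0).
  by exists 0 => x; rewrite linear0r.
have [p Mp hp] := orthogonal_projection hdot subM closedM x0.
set y := x0 - p in hp.
have fy : f y != 0 by rewrite fB (Mp : f p = 0) subr0; exact/eqP.
have y0 : dot y y != 0.
  apply: contra_neq fy; rewrite hdot => /eqP; rewrite sqrf_eq0 normr_eq0.
  by move/eqP ->.
exists (conjc (f y / dot y y) *: y) => x.
have h1 : dot y (- (f x / f y) *: y + x) = 0.
  by apply: hp; rewrite /M /= linf mulNr divfK// addNr.
have : dot (- (f x / f y) *: y + x) y = 0 by rewrite dot_conj h1 conjc0.
rewrite linearDl/= linearZl_LR/= mulNr addrC => /eqP.
rewrite subr_eq0 => /eqP h.
have -> : dot x (conjc (f y / dot y y) *: y) = f y / dot y y * dot x y.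
  by rewrite linearZr_LR/=; congr (_ * _); exact: conjcK.
by rewrite h; field; rewrite ?y0 ?fy.
Qed.

Lemma adjointP T : bounded_op T ->
  bounded_op (adjoint dot T) /\
  forall x y, dot (T x) y = dot x (adjoint dot T y).
Proof.
move=> bT; rewrite /adjoint; case: xgetP => [S _ //|none].
have /(bounded_opP hdot)[linT [c c0 hc]] := bT.
have /choice[S hS] : forall y, exists z, forall x, dot (T x) y = dot x z.
  move=> y.
  apply: (@riesz_representation (fun x => dot (T x) y) (c * nrm y)) => [a u v|x].
    by rewrite linT linearDl/= linearZl_LR.
  apply: le_trans (dotA_le lid pid _ _) _.
  by rewrite mulrAC ler_wpM2r ?normA_ge0 ?hc.
exfalso; apply: (none S); split => [|x y]; last exact: hS.
apply/(bounded_opP hdot); split.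
  move=> a u v; apply: eq_dotr => x.
  by rewrite -hS !linearDr/= !linearZr_LR/= -!hS.
exists c => //; apply: (@A_adjoint_bounded _ _ dot id lid pid T) => //.
by move=> x y; rewrite /dotA hS.
Qed.

(** Uniform boundedness, following Sokal: a point is moved successively
    by steps of length [3 ^- k] along the [k]-th vector, in the direction that
    increases the pairing with it; all later steps together have half that
    length and cannot undo the gain. *)
Lemma weakly_bounded_bounded (B : set H) :
  (forall x, exists c, forall b, B b -> `|rd x b| <= c) ->
  exists c, forall b, B b -> nrm b <= c.
Proof.
move=> wB; apply: contrapT => unbounded.
have /choice[b hb] : forall k : nat, exists b, B b /\
    2 * k.+1%:R * 3 ^+ k < nrm b.
  move=> k; apply: contrapT => hk; apply: unbounded.
  exists (2 * k.+1%:R * 3 ^+ k) => b Bb; rewrite leNgt; apply/negP => h.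
  by apply: hk; exists b.
pose r (k : nat) : R := 3 ^- k.
have r0 k : 0 < r k by rewrite invr_gt0 exprn_gt0.
have rS k : r k.+1 = r k / 3 by rewrite /r exprS invfM mulrC.
have b0 k : 0 < nrm (b k).
  by apply: le_lt_trans (hb k).2; rewrite mulr_ge0 ?mulr_ge0 ?exprn_ge0.
pose d k := (r k / nrm (b k))%:C%C *: b k.
pose step k v := if 0 <= rd v (b k) then v + d k else v - d k.
pose fix u k := if k is j.+1 then step j (u j) else 0.
have nd k : nrm (d k) = r k.
  by rewrite normAZr// ger0_norm ?divr_ge0 ?ltW// divfK// gt_eqF.
have rdd k : rd (d k) (b k) = r k * nrm (b k).
  rewrite (rdotZl _ lid) (rdotxx pid) expr2 mulrA divfK//.
  by rewrite gt_eqF.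
have stepE k : nrm (u k.+1 - u k) = r k.
  rewrite /= /step; case: ifP => _; rewrite addrC addKr ?nd//.
  by rewrite (normAN lid pid) nd.
have gain k : r k * nrm (b k) <= `|rd (u k.+1) (b k)|.
  rewrite /= /step; case: ifPn => [h|]; last rewrite -ltNge => h.
    by rewrite (rdotDl _ lid) rdd ger0_norm ?lerDr// addr_ge0// mulr_ge0 ?ltW.
  rewrite (rdotDl _ lid) (rdotNl _ lid) rdd ltr0_norm; last first.
    by rewrite -opprB oppr_lt0 subr_gt0 (lt_trans h)// mulr_gt0.
  by rewrite opprB lerDl oppr_ge0 ltW.
have tail k m : (k <= m)%N -> nrm (u m - u k) <= 3 / 2 * (r k - r m).
  elim: m => [|m IH].
    by rewrite leqn0 => /eqP ->; rewrite !subrr normA0// mulr0.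
  rewrite leq_eqVlt => /predU1P[->|]; first by rewrite !subrr normA0// mulr0.
  rewrite ltnS => /IH h; rewrite -(subrKA (u m)).
  apply: le_trans (normAD lid pid _ _) _; rewrite stepE rS; lra.
have [||x hx] := cvg_of_tail_bound hdot (u := u) (e := fun k => 3 / 2 * r k).
- move=> e e0.
  have [|N hN] := @exists_invn_lt R (2 / 3 * e); first by rewrite mulr_gt0.
  exists N; rewrite -ltr_pdivlMl// invf_div; apply: le_lt_trans hN.
  by rewrite lef_pV2 ?posrE ?exprn_gt0// -natrX ler_nat ltn_expl.
- move=> k m km; apply: le_trans (tail _ _ km) _.
  by rewrite ler_wpM2l// lerBlDr lerDl ltW.
have [c hc] := wB x.
have [k hk] : exists k : nat, c < k.+1%:R.
  by exists (Num.truncn c); exact: truncnS_gt.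
have := hc _ (hb k).1; apply/negP; rewrite -ltNge; apply: lt_le_trans hk _.
have := rdot_abs_le lid pid (x - u k.+1) (b k).
have : nrm (x - u k.+1) * nrm (b k) <= r k / 2 * nrm (b k).
  by rewrite ler_wpM2r ?normA_ge0//; have := hx k.+1; rewrite rS; lra.
have : k.+1%:R <= r k * nrm (b k) / 2.
  rewrite ler_pdivlMr// mulrC [_ * nrm _]mulrC ler_pdivlMr ?exprn_gt0//.
  exact/ltW/(hb k).2.
have := gain k; rewrite (rdotDl _ lid) (rdotNl _ lid).
have := lerB_dist (rd (u k.+1) (b k)) (rd x (b k)).
by rewrite distrC; lra.
Qed.

End HilbertOperators.

(** * Reduced solutions and A-boundedness *)

Section ReducedSolution.
Variables (R : realType) (H : completeNormedModType R[i]).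
Variable dot : {dot H for (@Num.conj R[i])}.
Hypothesis hdot : hilbert_dot dot.
Variable A : H -> H.
Hypothesis bA : bounded_op A.
Hypothesis posA : positive_op dot A.
Implicit Types (x y z : H) (T : H -> H) (e c : R).

Local Notation nrm := (normA dot id).
Local Notation rd := (rdot dot id).
Local Notation lid := (@linear_id R H).
Local Notation pid := (positive_id hdot).
Local Notation n := (normA dot A).

Let linA : linear A. Proof. by case: bA. Qed.

Lemma positive_selfadjoint x y : dot (A x) y = dot x (A y).
Proof. by rewrite (dot_conj hdot (A y)); exact: dotA_sym. Qed.

(** The metric closure of [range A]. *)
Let M : set H := [set x | forall e, 0 < e -> exists u, nrm (x - A u) < e].

Let M_closure : M `<=` closure (range A).
Proof.
move=> x Mx B /nbhs_ballP[r /= r0 rB].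
have /complex_realP[e re] : r \is Num.real by rewrite gtr0_real.
move: r0 rB; rewrite re ltcR => e0 rB; have [u hu] := Mx _ e0.
exists (A u); split; first by exists u.
by apply: rB; rewrite -ball_normE /= (hnormE hdot) ltcR.
Qed.

Let M_range u : M (A u).
Proof. by move=> e e0; exists u; rewrite subrr normA0. Qed.

Let M_subspace : linear_subspace M.
Proof.
split=> [|c x y Mx My e e0].
  by rewrite -(linear_at0 linA); exact: M_range.
have c1 : 0 < Normc.normc c + 1 by rewrite ltr_wpDl ?normc_ge0.
have [|u hu] := Mx (e / 2 / (Normc.normc c + 1)); first by rewrite !divr_gt0.
have [|v hv] := My (e / 2); first by rewrite divr_gt0.
exists (c *: u + v); rewrite linA opprD addrACA -scalerBr.
apply: le_lt_trans (normAD lid pid _ _) _; rewrite normAZ//.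
have : Normc.normc c * nrm (x - A u) <= (Normc.normc c + 1) * nrm (x - A u).
  by rewrite ler_wpM2r ?normA_ge0// lerDl.
by move: hu; rewrite ltr_pdivlMr// => hu; lra.
Qed.

Let M_closed : norm_closed dot M.
Proof.
move=> x hx e e0; have [|m Mm hm] := hx (e / 2); first by rewrite divr_gt0.
have [|u hu] := Mm (e / 2); first by rewrite divr_gt0.
exists u; rewrite -(subrKA m); apply: le_lt_trans (normAD lid pid _ _) _; lra.
Qed.

(** A vector of the closure of [range A] is determined in norm by its pairings
    with [range A], because it can be approximated from there. *)
Let M_bound x c : 0 <= c -> M x -> (forall u, rd x (A u) <= c * nrm (A u)) ->
  nrm x <= c.
Proof.
move=> c0 Mx hx; have [x0|x0] := eqVneq (nrm x) 0; first by rewrite x0.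
have xp : 0 < nrm x by rewrite lt_def x0 normA_ge0.
rewrite -(ler_pM2r xp) -expr2; apply/ler_addgt0Pr => e e0.
have k0 : 0 < c + nrm x by rewrite ltr_wpDl.
have [|u hu] := Mx (e / (c + nrm x)); first by rewrite divr_gt0.
move: hu; rewrite ltr_pdivlMr// => hu.
have h1 : nrm (A u) <= nrm x + nrm (x - A u).
  rewrite (normA_subC lid pid); rewrite -{1}(subrK x (A u)) addrC.
  exact: normAD lid pid _ _.
have h2 := rdot_le lid pid x (x - A u).
have h3 := hx u; have := ler_wpM2l c0 h1.
rewrite -(rdotxx pid); move: h2; rewrite (rdotDr dot id) (rdotNr lid pid).
lra.
Qed.

Let M_ker x : M x -> A x = 0 -> x = 0.
Proof.
move=> Mx Ax; apply: (nrm_eq0 hdot); apply/eqP; rewrite eq_le normA_ge0 andbT.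
apply: M_bound => // u.
by rewrite /rdot /dotA -positive_selfadjoint Ax linear0l mul0r.
Qed.

Section Operator.
Variable T : H -> H.
Hypothesis hT : B_A dot A T.

Let bT : bounded_op T. Proof. by case: hT. Qed.
Let linT : linear T. Proof. by case: bT. Qed.
Let T' := adjoint dot T.
Let adjT x y : dot (T x) y = dot x (T' y).
Proof. exact: (adjointP hdot bT).2. Qed.

Let adjoint_range y : exists z, A z = T' (A y).
Proof.
by have [z _ zE] := hT.2 (T' (A y)) (ex_intro2 _ _ y I erefl); exists z.
Qed.

(** If [A z = T' (A x)] then [<x, A T u> = <z, A u>] for all [u]: the vectors
    [A T u] with [A u] in the unit ball are weakly bounded. *)
Lemma range_majorization :
  exists2 c, 0 <= c & forall u, nrm (A (T u)) <= c * nrm (A u).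
Proof.
pose B : set H := [set A (T u) | u in [set u | nrm (A u) <= 1]].
have [x|c hc] := weakly_bounded_bounded hdot (B := B).
  have [z hz] := adjoint_range x; exists (nrm z) => _ [u /= hu <-].
  have -> : rd x (A (T u)) = rd z (A u).
    rewrite /rdot /dotA /= -!positive_selfadjoint hz.
    by rewrite (dot_conj hdot) adjT -(dot_conj hdot).
  apply: le_trans (rdot_abs_le lid pid _ _) _.
  by rewrite -[X in _ <= X]mulr1 ler_wpM2l ?normA_ge0.
have scale (t : R) u : 0 < t -> t * nrm (A u) <= 1 -> t * nrm (A (T u)) <= c.
  move=> t0 h; have := hc (A (T (t%:C%C *: u))).
  rewrite !(linear_scale linT, linear_scale linA) normAZr// gtr0_norm//; apply.
  exists (t%:C%C *: u); last by rewrite (linear_scale linT) (linear_scale linA).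
  by rewrite /= (linear_scale linA) normAZr// gtr0_norm.
have c0 : 0 <= c.
  have := @scale 1 0 ltr01.
  rewrite mul1r (linear_at0 linA) normA0// => /(_ ler01).
  by apply: le_trans; rewrite mul1r normA_ge0.
exists c => // u; have [u0|u0] := eqVneq (nrm (A u)) 0; last first.
  have up : 0 < nrm (A u) by rewrite lt_def u0 normA_ge0.
  have := scale (nrm (A u))^-1 u; rewrite invr_gt0 mulVf// => /(_ up (lexx _)).
  by rewrite mulrC ler_pdivrMr.
rewrite u0 mulr0 leNgt; apply/negP => p0.
have t0 : 0 < (c + 1) / nrm (A (T u)) by rewrite divr_gt0// ltr_wpDl.
have := scale _ u t0; rewrite u0 mulr0 ler01 divfK ?gt_eqF// => /(_ isT).
by rewrite leNgt ltrDl ltr01.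
Qed.

(** Linearity comes from uniqueness, because [A] is injective on the closure of
    its range; boundedness comes from [<X y, A u> = <y, A T u>]. *)
Lemma reduced_solution_exists : exists X : H -> H,
  [/\ bounded_op X, A \o X = T' \o A & range X `<=` closure (range A)].
Proof.
have /choice[X hX] : forall y, exists p, M p /\ A p = T' (A y).
  move=> y; have [z hz] := adjoint_range y.
  have [p Mp hp] := orthogonal_projection hdot M_subspace M_closed z.
  exists p; split=> //; rewrite -hz; apply: (eq_dotr hdot) => x.
  apply/eqP; rewrite eq_sym -subr_eq0 -linearBr/= -(linear_sub linA).
  rewrite -positive_selfadjoint (dot_conj hdot) hp ?conjc0//.
exists X; split; last 2 first.
- by apply/funext => y; exact: (hX y).2.
- by move=> _ [y _ <-]; exact/M_closure/(hX y).1.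
have [bT' _] := adjointP hdot bT.
have linT' : linear T' by case: bT'.
apply/(bounded_opP hdot); split.
  move=> a x y; apply/eqP; rewrite -subr_eq0; apply/eqP/M_ker.
    rewrite -scaleN1r [X _ + _]addrC; apply: M_subspace.2; last exact: (hX _).1.
    by apply: M_subspace.2; exact: (hX _).1.
  by rewrite (linear_sub linA) linA !(hX _).2 linA linT' subrr.
have [c c0 hc] := range_majorization; exists c => // y.
apply: M_bound; [by rewrite mulr_ge0 ?normA_ge0|exact: (hX y).1|move=> u].
have -> : rd (X y) (A u) = rd y (A (T u)).
  rewrite /rdot /dotA /= -!positive_selfadjoint (hX y).2.
  by rewrite (dot_conj hdot) -adjT -(dot_conj hdot).
apply: le_trans (rdot_le lid pid _ _) _.
by rewrite -mulrA mulrCA ler_wpM2l ?normA_ge0 ?hc.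
Qed.

Lemma sharpP : bounded_op (sharp dot A T) /\ A_adjoint dot A T (sharp dot A T).
Proof.
rewrite /sharp; case: xgetP => [X _ [bX XE _]|none]; last first.
  by have [X hX] := reduced_solution_exists; have := none X.
split=> // x y; rewrite /dotA positive_selfadjoint adjT.
by rewrite -[T' (A y)]/((T' \o A) y) -XE /= positive_selfadjoint.
Qed.

End Operator.

(** Following Lax: along the orbit of [x] the seminorm is log-convex,
    [n (K y) ^+ 2 <= n y * n (K (K y))], so it grows at least geometrically
    with the ratio of its first two values; boundedness of [K] caps that
    ratio by the operator norm. *)
Lemma selfadjoint_seminorm_le K c : linear K -> 0 <= c ->
  (forall x, nrm (K x) <= c * nrm x) -> A_adjoint dot A K K ->
  forall x, n (K x) <= c * n x.
Proof.
move=> linK c0 hK adj x.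
have logconvex y : n (K y) ^+ 2 <= n y * n (K (K y)).
  by rewrite -(rdotxx posA) (rdot_adjoint _ _ adj) rdot_le.
have [a a0 ha] : exists2 a, 0 <= a & forall y, n y <= a * nrm y.
  have /(bounded_opP hdot)[_ [a a0 ha]] := bA; exists (Num.sqrt a).
    exact: sqrtr_ge0.
  move=> y.
  rewrite -(ler_pXn2r (n := 2)) ?nnegrE ?mulr_ge0 ?sqrtr_ge0 ?normA_ge0//.
  rewrite exprMn (sqr_sqrtr a0) -(rdotxx posA) -[rdot _ _ _ _]/(rd (A y) y).
  apply: le_trans (rdot_le lid pid _ _) _.
  by rewrite expr2 mulrA ler_wpM2r ?normA_ge0 ?ha.
have iter_le k : nrm (iter k K x) <= c ^+ k * nrm x.
  elim: k => [|k IH]; first by rewrite mul1r.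
  by rewrite iterS exprS -mulrA; apply: le_trans (hK _) _; rewrite ler_wpM2l.
have [x0|x0] := eqVneq (n x) 0.
  have := logconvex x; rewrite x0 mul0r mulr0 => h.
  by rewrite -(ler_pXn2r (n := 2)) ?nnegrE ?normA_ge0// expr0n.
have xp : 0 < n x by rewrite lt_def x0 normA_ge0.
have [K0|K0] := eqVneq (n (K x)) 0; first by rewrite K0 mulr_ge0 ?normA_ge0.
have Kp : 0 < n (K x) by rewrite lt_def K0 normA_ge0.
rewrite -ler_pdivrMr//; set r := n (K x) / n x.
have r0 : 0 < r by rewrite divr_gt0.
have grow k : 0 < n (iter k K x) /\ r * n (iter k K x) <= n (iter k.+1 K x).
  elim: k => [|k [kp hk]]; first by rewrite /= divfK ?lexx.
  have kp1 : 0 < n (iter k.+1 K x) by apply: lt_le_trans hk; rewrite mulr_gt0.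
  split=> //; rewrite -(ler_pM2l kp); apply: le_trans (logconvex _).
  by rewrite expr2 mulrA [_ * r]mulrC ler_wpM2r ?normA_ge0.
apply: (le_of_geometric_growth (a := n x) (C := a * nrm x)) => // k.
apply: (@le_trans _ _ (n (iter k K x))); last first.
  apply: le_trans (ha _) _; rewrite -mulrA ler_wpM2l// mulrC; exact: iter_le.
elim: k => [|k IH]; first by rewrite mul1r.
rewrite exprS -mulrA; apply: le_trans (grow k).2.
by apply: ler_wpM2l => //; exact: ltW.
Qed.

(** [n (T x) ^+ 2 = <W T x, x>_A] with [W T] A-selfadjoint and bounded. *)
Lemma B_A_seminorm_bounded T : B_A dot A T -> seminorm_bounded dot A T.
Proof.
move=> hT; have [bW adj] := sharpP hT; set W := sharp dot A T in bW adj.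
have /(bounded_opP hdot)[linT [c c0 hc]] : bounded_op T by case: hT.
have /(bounded_opP hdot)[linW [d d0 hd]] := bW.
have adj' := A_adjoint_sym linA posA adj.
have hK : forall x, n (W (T x)) <= d * c * n x.
  apply: (@selfadjoint_seminorm_le (W \o T)) => [|||x y /=]; rewrite ?mulr_ge0//.
  - exact: linear_comp.
  - by move=> x /=; apply: le_trans (hd _) _; rewrite -mulrA ler_wpM2l ?hc.
  - by rewrite adj' adj.
exists (Num.sqrt (d * c)) => x.
rewrite -(ler_pXn2r (n := 2)) ?nnegrE ?mulr_ge0 ?sqrtr_ge0 ?normA_ge0//.
rewrite exprMn (sqr_sqrtr (mulr_ge0 d0 c0)) -(rdotxx posA) (rdot_adjoint _ _ adj).
rewrite (rdotC linA posA); apply: le_trans (rdot_le linA posA _ _) _.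
by rewrite expr2 mulrA ler_wpM2r ?normA_ge0 ?hK.
Qed.

End ReducedSolution.

(** * The inequality *)

Theorem theorem3p6 (R : realType) (H : completeNormedModType R[i])
    (dot : {dot H for (@Num.conj R[i])}) (hdot : hilbert_dot dot)
    (A : H -> H) (bA : bounded_op A) (posA : positive_op dot A)
    (T S X Y : H -> H) (hT : B_A dot A T) (hS : B_A dot A S)
    (hX : B_A dot A X) (hY : B_A dot A Y) :
  let bound := 2 * Num.sqrt 2 * opnormA dot A S
    * Num.max (opnormA dot A X) (opnormA dot A Y)
    * Num.sqrt (numradA dot A T ^+ 2
        - `|opnormA dot A (ReA dot A T) ^+ 2
            - opnormA dot A (ImA dot A T) ^+ 2| / 2) in
  numradA dot A ((T \o X \o S) \+ (S \o Y \o T)) <= bound /\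
  numradA dot A ((T \o X \o S) \- (S \o Y \o T)) <= bound.
Proof.
have linA : linear A by case: bA.
have lin U : B_A dot A U -> linear U by case=> -[].
have bnd U := @B_A_seminorm_bounded R H dot hdot A bA posA U.
have [[linT' _] adjT] := sharpP hdot bA posA hT.
have [_ adjS] := sharpP hdot bA posA hS.
split.
- by apply: (numradA_sum_le linA posA (T' := sharp dot A T)
    (S' := sharp dot A S)); auto.
- by apply: (numradA_sub_le linA posA (T' := sharp dot A T)
    (S' := sharp dot A S)); auto.
Qed.
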